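(* Let $n\geq 2$. Assume there is a well-order of the Baire space $\mathcal{N}=\omega^\omega$ which is $\mathbf{\Delta}^1_n$ as a subset of $\mathcal{N}\times\mathcal{N}$. Then for every locally countable $\mathbf{\Delta}^1_n$ graph $G$ we have $\chi_{\mathbf{\Delta}^1_{n+1}}(G)=\chi(G)$.
   Context: The boldface projective classes $\mathbf{\Sigma}^1_n,\mathbf{\Pi}^1_n,\mathbf{\Delta}^1_n$ are the usual ones on Polish spaces. A graph is a pair $G=(V,E)$ with $E\subseteq V\times V$ symmetric. For a pointclass $\mathbf{P}$, a $\mathbf{P}$ graph is a graph whose vertex set $V$ is a Polish space and whose edge set $E$ is a $\mathbf{P}$ subset of $V\times V$. $G$ is locally countable if every vertex has at most countably many neighbours. A $\kappa$-colouring is a map from $V$ to a set of cardinality $\kappa$ assigning distinct values to adjacent vertices; $\chi(G)$ is the least such $\kappa$. A $\mathbf{P}$ class $\kappa$-colouring is a $\kappa$-colouring each of whose colour classes is in $\mathbf{P}$; $\chi_{\mathbf{P}}(G)$ is the least $\kappa$ for which one exists. *)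

(* Defs.v *)
From HB Require Import structures.
From mathcomp Require Import all_boot all_order all_algebra.
From mathcomp Require Export all_classical all_reals all_analysis.

Set Implicit Arguments.
Unset Strict Implicit.
Unset Printing Implicit Defensive.

Import Order.TTheory GRing.Theory Num.Theory.
Local Open Scope classical_set_scope.
Local Open Scope ring_scope.

(** * Polish spaces *)

Definition is_metric (R : realType) (T : Type) (d : T -> T -> R) : Prop :=
  [/\ forall x y, 0 <= d x y,
      forall x y, d x y = 0 <-> x = y,
      forall x y, d x y = d y x &
      forall x y z, d x z <= d x y + d y z].

Definition metrizes (R : realType) (T : topologicalType) (d : T -> T -> R) :
    Prop :=
  forall (x : T) (A : set T),
    nbhs x A <-> exists2 e : R, 0 < e & [set y | d x y < e] `<=` A.

Definition complete_metric (R : realType) (T : topologicalType)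
    (d : T -> T -> R) : Prop :=
  forall u : nat -> T,
    (forall e : R, 0 < e ->
       exists N : nat, forall m k : nat,
         (N <= m)%N -> (N <= k)%N -> d (u m) (u k) < e) ->
    exists l : T, u @ \oo --> l.

(* The library's [completeType] is pointed, so it would exclude the empty
   Polish space; hence the direct definition.  Completeness is stated with
   convergence in the topology of [T], which [metrizes] identifies with
   convergence for [d]. *)
Definition polish (R : realType) (T : topologicalType) : Prop :=
  (exists2 D : set T, countable D & dense D) /\
  (exists d : T -> T -> R, [/\ is_metric d, metrizes d & complete_metric d]).

(** * Projective classes *)

Definition baire : topologicalType := prod_topology (fun _ : nat => nat).

(* Level 0 is the Borel sets, so that level 1 is the projections along the
   Baire space of Borel sets, i.e. the analytic sets; level n+1 is the
   projections of the complements of level n sets. *)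
Fixpoint Sigma1 (n : nat) (X : topologicalType) : set (set X) :=
  if n is m.+1 then
    [set A | exists2 B : set (X * baire),
       @Sigma1 m (X * baire)%type (~` B) & A = fst @` B]
  else <<s @open X >>.

Definition Pi1 (n : nat) (X : topologicalType) : set (set X) :=
  [set A | Sigma1 n (~` A)].

Definition Delta1 (n : nat) (X : topologicalType) : set (set X) :=
  @Sigma1 n X `&` @Pi1 n X.

(** * Graphs and colourings *)

Definition is_graph (V : Type) (E : set (V * V)) : Prop :=
  forall x y, E (x, y) -> E (y, x).

Definition locally_countable (V : Type) (E : set (V * V)) : Prop :=
  forall x, countable [set y | E (x, y)].

Definition colouring (V K : Type) (E : set (V * V)) (c : V -> K) : Prop :=
  forall x y, E (x, y) -> c x <> c y.

Definition class_colouring (V K : Type) (P : set (set V)) (E : set (V * V))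
    (c : V -> K) : Prop :=
  colouring E c /\ forall k : K, P (c @^-1` [set k]).

Definition colourable (V : Type) (E : set (V * V)) (K : Type) : Prop :=
  exists c : V -> K, colouring E c.

Definition class_colourable (V : Type) (P : set (set V)) (E : set (V * V))
    (K : Type) : Prop :=
  exists c : V -> K, class_colouring P E c.

(* Cardinals are represented by types: [least_cardinal Q kappa] says that the
   cardinality of [kappa] is the least one of a type satisfying [Q]. *)
Definition least_cardinal (Q : Type -> Prop) (kappa : Type) : Prop :=
  Q kappa /\ forall K : Type, Q K -> ([set: kappa] #<= [set: K])%card.

Definition chromatic_number (V : Type) (E : set (V * V)) : Type -> Prop :=
  least_cardinal (colourable E).

Definition class_chromatic_number (V : Type) (P : set (set V))
    (E : set (V * V)) : Type -> Prop :=
  least_cardinal (class_colourable P E).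

(** * Existence of the chromatic number

    A vertex adjacent to itself rules out all colourings; otherwise a locally
    countable graph is countably colourable and [chromatic_number E] is
    attained. *)

Fixpoint ball_at (V : Type) (E : set (V * V)) (n : nat) (x : V) : set V :=
  if n is m.+1 then \bigcup_(y in [set y | E (x, y)]) ball_at E m y
  else [set x].

Lemma colourable_nat (V : Type) (E : set (V * V)) :
  is_graph E -> locally_countable E -> (forall x, ~ E (x, x)) ->
  colourable E nat.
Proof.
move=> symE lcE irrE.
pose comp x : set V := \bigcup_n ball_at E n x.
have comp_sub x y : E (x, y) -> comp y `<=` comp x.
  by move=> Exy z [n _ nyz]; exists n.+1 => //=; exists y.
have comp_eq x y : E (x, y) -> comp x = comp y.
  by move=> Exy; apply/seteqP; split; apply: comp_sub => //; apply: symE.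
have compx x : comp x x by exists 0%N.
have cball n x : countable (ball_at E n x).
  elim: n x => [|n IHn] x /=; first exact: countable1.
  by apply: bigcup_countable => [|y _]; [exact: lcE|exact: IHn].
have ccomp x : countable (comp x) by apply: bigcup_countable.
have /choice[f fP] : forall A : set V, exists g : V -> nat,
    countable A -> {in A &, injective g}.
  move=> A; have [/countable_injP[g gP]|nA] := pselect (countable A).
    by exists g.
  by exists (fun=> 0%N).
exists (fun x => f (comp x) x) => x y Exy; rewrite (comp_eq _ _ Exy) => fxy.
have xy : x = y.
  apply: (fP _ (ccomp y)) fxy; rewrite inE; last exact: compx.
  by rewrite -(comp_eq _ _ Exy).
by apply: (irrE x); rewrite {2}xy.
Qed.

Lemma chromatic_number_ex (V : Type) (E : set (V * V)) :
  is_graph E -> locally_countable E -> (forall x, ~ E (x, x)) ->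
  exists kappa : Type, chromatic_number E kappa.
Proof.
move=> symE lcE irrE.
have finK (K : Type) : colourable E K -> finite_set [set: K] ->
    exists2 k, colourable E 'I_k & ([set: 'I_k] #<= [set: K])%card.
  move=> [c cP] /finite_setP[k Kk].
  have KI : ([set: K] #= [set: 'I_k])%card by apply: card_eq_trans Kk card_II.
  exists k; last by rewrite (card_le_eqr KI).
  have [g [gfun ginj _]] := elimT card_set_bijP Kk.
  have gk x : (g x < k)%N by exact: gfun.
  exists (fun x => Ordinal (gk (c x))) => x y Exy [gxy]; apply: (cP _ _ Exy).
  by apply: ginj gxy; rewrite inE.
have [exk|nok] := pselect (exists k, `[< colourable E 'I_k >]).
  exists 'I_(ex_minn exk); case: ex_minnP => m /asboolP colm minm.
  split=> // K colK; have [finite_K|/infiniteP infK] := pselect (finite_set [set: K]).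
    have [k /asboolP/minm mk kK] := finK _ colK finite_K.
    apply: card_le_trans kK; rewrite -(card_le_eql card_II).
    by rewrite -(card_le_eqr card_II) card_le_II.
  by apply: card_le_trans infK; exact: countableP.
exists nat; split; first exact: colourable_nat.
move=> K colK; apply/infiniteP => /(finK _ colK)[k colk _]; apply: nok.
by exists k; apply/asboolP.
Qed.

(* Main.v *)
Require Import Defs.
From mathcomp Require Import all_boot all_order all_algebra.
From mathcomp Require Import all_classical all_reals all_analysis.
From mathcomp Require Import wochoice.
From mathcomp Require Import lra.

(** The components of [E] are countable, so a real [z] can code an enumeration
    of a component together with a proper labelling of it by colours.  Giving
    each vertex the label it gets in the least code of its component is a
    colouring.  Taken literally, leastness is too complex, because "[z]
    enumerates the component of [x]" is not Delta^1_n.  But if some [w]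
    enumerates that component, then "[z] codes the component of [x]" becomes
    "[z] has the same range as [w] and its labelling is proper", which is
    Delta^1_n; so leastness relative to [w] is Pi^1_n, and quantifying
    existentially over [w] and [z] gives Sigma^1_(n+1) colour classes.  These
    classes are countably many and partition the space, so they are
    Delta^1_(n+1). *)

Set Implicit Arguments.
Unset Strict Implicit.
Unset Printing Implicit Defensive.

Import Order.TTheory GRing.Theory Num.Theory.
Local Open Scope classical_set_scope.

(** * Projective sets *)

Lemma continuous_pair (X Y Z : topologicalType) (f : X -> Y) (g : X -> Z) :
  continuous f -> continuous g -> continuous (fun x => (f x, g x)).
Proof. by move=> cf cg x; apply: cvg_pair; [exact: cf|exact: cg]. Qed.

Lemma continuous_fst (X Y Z : topologicalType) (f : X -> Y * Z) :
  continuous f -> continuous (fun x => (f x).1).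
Proof.
by move=> cf x; apply: (@continuous_comp _ _ _ f fst _ (cf x)); exact: cvg_fst.
Qed.

Lemma continuous_snd (X Y Z : topologicalType) (f : X -> Y * Z) :
  continuous f -> continuous (fun x => (f x).2).
Proof.
by move=> cf x; apply: (@continuous_comp _ _ _ f snd _ (cf x)); exact: cvg_snd.
Qed.

Lemma continuous_coord (X : topologicalType) (f : X -> baire) (i : nat) :
  continuous f -> continuous (fun x => f x i).
Proof.
move=> cf x; apply: (@continuous_comp _ _ _ f (@proj _ (fun=> nat) i) _ (cf x)).
exact: (@proj_continuous _ (fun _ : nat => nat) i).
Qed.

Lemma continuous_baire (X : topologicalType) (f : X -> baire) :
  (forall i, continuous (fun x => f x i)) -> continuous f.
Proof.
move=> cf x; apply/(@pointwise_cvgP nat nat) => i; exact: cf.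
Qed.

Lemma continuous_id (X : topologicalType) : continuous (fun x : X => x).
Proof. by move=> x; exact: cvg_id. Qed.

Definition slice (z : baire) (i : nat) : baire := fun j => z (pickle (i, j)).

(** One real packs a whole sequence of reals; positions where [unpickle] fails get the default 0. *)
Lemma slice_surj (u : nat -> baire) : exists z, forall i, slice z i = u i.
Proof.
exists (fun k => if unpickle k is Some p then u p.1 p.2 else 0) => i.
by apply/funext => j; rewrite /slice pickleK.
Qed.

Lemma continuous_slice (X : topologicalType) (f : X -> baire) (i : nat) :
  continuous f -> continuous (fun x => slice (f x) i).
Proof. by move=> cf; apply: continuous_baire => j; exact: continuous_coord. Qed.

Ltac cont := repeat first
  [ assumption | apply: continuous_id | apply: continuous_pair
  | apply: continuous_fst | apply: continuous_snd | apply: continuous_slice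
  | apply: continuous_coord ].

(** * Borel sets and closure properties of the classes [Sigma1] *)

Lemma borelC (X : topologicalType) (A : set X) :
  <<s @open X >> A -> <<s @open X >> (~` A).
Proof. by rewrite -setTD; exact: sigma_algebraCD. Qed.

Lemma borel_open (X : topologicalType) (A : set X) :
  open A -> <<s @open X >> A.
Proof. exact: sub_sigma_algebra. Qed.

Lemma borel_preimage (X Y : topologicalType) (f : X -> Y) (A : set Y) :
  continuous f -> <<s @open Y >> A -> <<s @open X >> (f @^-1` A).
Proof.
move=> /continuousP cf.
apply: (@smallest_sub _ _ _ [set B | <<s @open X >> (f @^-1` B)]).
  split=> /= [|B fB|F fF].
      by rewrite preimage_set0; exact: sigma_algebra0.
    by rewrite setTD -preimage_setC; exact: borelC.
  by rewrite preimage_bigcup; exact: sigma_algebra_bigcup.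
by move=> B oB /=; apply: borel_open; exact: cf.
Qed.

(** The set being projected is pulled back along [f] times the identity of the Baire space; the
    induction therefore ranges over all spaces at once. *)
Lemma Sigma1_preimage (n : nat) (X Y : topologicalType) (f : X -> Y)
    (A : set Y) :
  continuous f -> Sigma1 n A -> Sigma1 n (f @^-1` A).
Proof.
elim: n X Y f A => [|n IHn] X Y f A cf; first exact: borel_preimage.
move=> [B SB ->]; exists ((fun p : X * baire => (f p.1, p.2)) @^-1` B).
  rewrite preimage_setC; apply: IHn SB; cont.
  by move=> p; apply: (@continuous_comp _ _ _ fst f);
    [exact: cvg_fst|exact: cf].
apply/seteqP; split=> x /=.
  by move=> [[y z] /= Bz yx]; exists (x, z); rewrite //= -yx.
by move=> [[y z] /= Bz <-]; exists (f y, z).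
Qed.

Lemma Sigma1_borel (n : nat) (X : topologicalType) (A : set X) :
  <<s @open X >> A -> Sigma1 n A.
Proof.
elim: n X A => [//|n IHn] X A bA; exists (fst @^-1` A).
  rewrite preimage_setC; apply: IHn; apply: borel_preimage; last exact: borelC.
  by cont.
apply/seteqP; split=> [x Ax|x [p /= Ap <- //]].
by exists (x, fun=> 0).
Qed.

Lemma Sigma1_nat (n : nat) (X : topologicalType) (f : X -> nat) (P : set nat) :
  continuous f -> Sigma1 n [set x | P (f x)].
Proof.
move=> /continuousP cf; apply: Sigma1_borel; apply: borel_open.
by apply: (cf P); exact: discrete_open.
Qed.

(** Both halves go through one induction: the projected set is described by its complement one level
    down, and for the union this complement is a countable union of binary intersections. *)
Lemma Sigma1_bigcup_bigcap (n : nat) (X : topologicalType) (F : nat -> set X) :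
  (forall i, Sigma1 n (F i)) ->
  Sigma1 n (\bigcup_i F i) /\ Sigma1 n (\bigcap_i F i).
Proof.
elim: n X F => [|n IHn] X F SF.
  split; first exact: sigma_algebra_bigcup.
  rewrite -[X in Sigma1 _ X]setCK setC_bigcap; apply: borelC.
  by apply: sigma_algebra_bigcup => i; apply: borelC; exact: SF.
have /choice[B BP] i : exists B : set (X * baire),
    Sigma1 n (~` B) /\ F i = fst @` B.
  by have [B] := SF i; exists B.
have SI (Y : topologicalType) (A C : set Y) :
    Sigma1 n A -> Sigma1 n C -> Sigma1 n (A `&` C).
  move=> SA SC; rewrite -bigcap2E; apply: (proj2 (IHn _ _ _)).
  by case=> [|[|i]] //=; apply: Sigma1_borel; apply: borel_open; exact: openT.
split.
  (* The first entry of slice 0 names the index of the set containing the point, and slice 1 is the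
     witness for that set. *)
  exists [set p : X * baire | B (slice p.2 0 0) (p.1, slice p.2 1)].
    rewrite (_ : ~` _ = \bigcup_i ([set p : X * baire | slice p.2 0 0 = i] `&`
        (fun p : X * baire => (p.1, slice p.2 1)) @^-1` (~` B i))).
      apply: (proj1 (IHn _ _ _)) => i; apply: (SI).
        apply: (@Sigma1_nat _ _ (fun p : X * baire => slice p.2 0 0) [set i]).
        by cont.
      by apply: Sigma1_preimage; [cont|exact: (BP i).1].
    apply/seteqP; split=> [p /= nB|p [i _ [/= <- //]]].
    by exists (slice p.2 0 0).
  apply/seteqP; split=> [x [i _]|x [[y z] /= Bz <-]].
    rewrite (BP i).2 => -[[y z] /= Bz <-].
    have [w wP] := slice_surj (fun j => if j is 0 then fun=> i else z).
    by exists (y, w); rewrite //= !wP.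
  by exists (slice z 0 0) => //; rewrite (BP _).2; exists (y, slice z 1).
(* By countable choice a single real carries witnesses for all the sets, slice [i] serving the
   [i]-th. *)
exists (\bigcap_i (fun p : X * baire => (p.1, slice p.2 i)) @^-1` B i).
  rewrite setC_bigcap; apply: (proj1 (IHn _ _ _)) => i.
  by rewrite preimage_setC; apply: Sigma1_preimage; [cont|exact: (BP i).1].
apply/seteqP; split=> [x Fx|x [[y z] /= Bz <- i _]].
  have /choice[u uP] i : exists z, B i (x, z).
    by have := Fx i I; rewrite (BP i).2 => -[[y z] /= Bz <-]; exists z.
  by have [w wP] := slice_surj u; exists (x, w) => //= i _ /=; rewrite wP.
by rewrite (BP i).2; exists (y, slice z i) => //; exact: Bz.
Qed.

Lemma Sigma1_bigcup (n : nat) (X : topologicalType) (F : nat -> set X) :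
  (forall i, Sigma1 n (F i)) -> Sigma1 n [set x | exists i, F i x].
Proof.
move=> /Sigma1_bigcup_bigcap[SF _]; rewrite (_ : mkset _ = \bigcup_i F i) //.
by apply/seteqP; split=> x [i]; [exists i|exists i].
Qed.

Lemma Sigma1_bigcap (n : nat) (X : topologicalType) (F : nat -> set X) :
  (forall i, Sigma1 n (F i)) -> Sigma1 n [set x | forall i, F i x].
Proof.
move=> /Sigma1_bigcup_bigcap[_ SF]; rewrite (_ : mkset _ = \bigcap_i F i) //.
by apply/seteqP; split=> x Fx i //; exact: Fx.
Qed.

Lemma Sigma1_and (n : nat) (X : topologicalType) (A B : set X) :
  Sigma1 n A -> Sigma1 n B -> Sigma1 n [set x | A x /\ B x].
Proof.
move=> SA SB; rewrite (_ : mkset _ = \bigcap_i bigcap2 A B i);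
  last by rewrite bigcap2E.
apply: (proj2 (Sigma1_bigcup_bigcap _)).
by case=> [|[|i]] //=; apply: Sigma1_borel; apply: borel_open; exact: openT.
Qed.

Lemma Sigma1_or (n : nat) (X : topologicalType) (A B : set X) :
  Sigma1 n A -> Sigma1 n B -> Sigma1 n [set x | A x \/ B x].
Proof.
move=> SA SB; rewrite (_ : mkset _ = \bigcup_i bigcup2 A B i);
  last by rewrite bigcup2E.
apply: (proj1 (Sigma1_bigcup_bigcap _)).
by case=> [|[|i]] //=; apply: Sigma1_borel; exact: sigma_algebra0.
Qed.

(** The new quantifier and the one hidden in the projection merge into one, over a real whose slices
    0 and 1 are the two witnesses. *)
Lemma Sigma1_ex (n : nat) (X : topologicalType) (A : set (X * baire)) :
  Sigma1 n.+1 A -> Sigma1 n.+1 [set x | exists z, A (x, z)].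
Proof.
move=> [B SB ->].
exists ((fun p : X * baire => ((p.1, slice p.2 0), slice p.2 1)) @^-1` B).
  by rewrite preimage_setC; apply: Sigma1_preimage SB; cont.
apply/seteqP; split=> [x [z [[[y v] w] /= Bw [<- _]]]|x [[y z] /= Bz <-]].
  have [u uP] := slice_surj (fun j => if j is 0 then v else w).
  by exists (y, u); rewrite //= !uP.
by exists (slice z 0); exists ((y, slice z 0), slice z 1).
Qed.

Lemma Pi1_Sigma1S (n : nat) (X : topologicalType) (A : set X) :
  Sigma1 n (~` A) -> Sigma1 n.+1 A.
Proof.
move=> SA; exists (fst @^-1` A).
  by rewrite preimage_setC; apply: Sigma1_preimage SA; cont.
apply/seteqP; split=> [x Ax|x [p /= Ap <- //]].
by exists (x, fun=> 0).
Qed.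

Lemma Sigma1S (n : nat) (X : topologicalType) (A : set X) :
  Sigma1 n A -> Sigma1 n.+1 A.
Proof.
elim: n X A => [|n IHn] X A; first exact: Sigma1_borel.
by move=> [B SB ->]; exists B => //; exact: IHn.
Qed.

(** * Closure properties of the classes [Pi1] and [Delta1] *)

Lemma Pi1_setC (n : nat) (X : topologicalType) (A B : set X) :
  ~` A = B -> Sigma1 n B -> Pi1 n A.
Proof. by move=> <-. Qed.

Lemma Delta1_preimage (n : nat) (X Y : topologicalType) (f : X -> Y)
    (A : set Y) :
  continuous f -> Delta1 n A -> Delta1 n [set x | A (f x)].
Proof.
move=> cf [SA PA]; split; first exact: (Sigma1_preimage cf SA).
exact: (Sigma1_preimage cf PA).
Qed.

Lemma Delta1C (n : nat) (X : topologicalType) (A : set X) :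
  Delta1 n A -> Delta1 n [set x | ~ A x].
Proof. by move=> [SA PA]; split=> //; rewrite /Pi1 /= setCK. Qed.

Lemma Delta1_forall (n : nat) (X : topologicalType) (F : nat -> set X) :
  (forall i, Delta1 n (F i)) -> Delta1 n [set x | forall i, F i x].
Proof.
move=> DF; split; first by apply: Sigma1_bigcap => i; exact: (DF i).1.
rewrite /Pi1 /= (_ : ~` _ = [set x | exists i, ~ F i x]).
  by apply: Sigma1_bigcup => i; exact: (DF i).2.
by apply/predeqP => x /=; rewrite existsNP.
Qed.

Lemma Delta1_exists (n : nat) (X : topologicalType) (F : nat -> set X) :
  (forall i, Delta1 n (F i)) -> Delta1 n [set x | exists i, F i x].
Proof.
move=> DF; rewrite (_ : mkset _ = [set x | ~ forall i, ~ F i x]).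
  by apply: Delta1C; apply: Delta1_forall => i; exact: Delta1C.
by apply/predeqP => x /=; rewrite not_existsP.
Qed.

Lemma Delta1_and (n : nat) (X : topologicalType) (A B : set X) :
  Delta1 n A -> Delta1 n B -> Delta1 n [set x | A x /\ B x].
Proof.
move=> [SA PA] [SB PB]; split; first exact: Sigma1_and.
rewrite /Pi1 /= (_ : ~` _ = [set x | ~ A x \/ ~ B x]); first exact: Sigma1_or.
by apply/predeqP => x /=; rewrite not_andE.
Qed.

Lemma Delta1_imply (n : nat) (X : topologicalType) (A B : set X) :
  Delta1 n A -> Delta1 n B -> Delta1 n [set x | A x -> B x].
Proof.
move=> DA DB; rewrite (_ : mkset _ = [set x | ~ (A x /\ ~ B x)]).
  by apply: Delta1C; apply: Delta1_and => //; exact: Delta1C.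
by apply/predeqP => x /=; rewrite -not_implyE notK.
Qed.

(** [P] may be arbitrary because [nat] is discrete: splitting over the values of [f] leaves only
    clopen conditions. *)
Lemma Delta1_nat (n : nat) (X : topologicalType) (f g : X -> nat)
    (P : nat -> nat -> Prop) :
  continuous f -> continuous g -> Delta1 n [set x | P (f x) (g x)].
Proof.
move=> cf cg; rewrite (_ : mkset _ = [set x | exists i, f x = i /\ P i (g x)]).
  apply: Delta1_exists => i; apply: Delta1_and.
    by split; [exact: (@Sigma1_nat _ _ f [set i])|
               exact: (@Sigma1_nat _ _ f (~` [set i]))].
  by split; [exact: (@Sigma1_nat _ _ g (P i))|
             exact: (@Sigma1_nat _ _ g (~` P i))].
by apply/predeqP => x /=; split=> [?|[i [->]]//]; exists (f x).
Qed.

Lemma Pi1_forall (n : nat) (X : topologicalType) (A : set (X * baire)) :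
  Pi1 n.+1 A -> Pi1 n.+1 [set x | forall z, A (x, z)].
Proof.
move=> PA; rewrite /Pi1 /= (_ : ~` _ = [set x | exists z, (~` A) (x, z)]).
  exact: Sigma1_ex.
by apply/predeqP => x /=; rewrite existsNP.
Qed.

(** * Polish spaces as continuous images of the Baire space *)

(** Repetitions are allowed, so finite sets are covered: numbers that code no element of [A] are
    sent to the default [a0]. *)
Lemma countable_enum (T : Type) (A : set T) :
  countable A -> A !=set0 -> exists f : nat -> T, range f = A.
Proof.
move=> /countable_injP[g gI] [a0 Aa0].
have /choice[f fP] k : exists a, A a /\ forall b, A b -> g b = k -> a = b.
  have [[a [Aa <-]]|nex] := pselect (exists a, A a /\ g a = k).
    by exists a; split=> // b Ab gba; apply: gI; rewrite ?inE.
  by exists a0; split=> // b Ab gb; case: nex; exists b.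
exists f; apply/seteqP; split=> [_ [k _ <-]|a Aa]; first exact: (fP k).1.
by exists (g a) => //; exact: (fP (g a)).2.
Qed.

Lemma halfX_lt (R : realType) (e : R) :
  (0 < e)%R -> exists k, (2^-1 ^+ k < e)%R.
Proof.
move=> e0; have [k ke] : exists k : nat, (e^-1 < k%:R)%R.
  by exists (Num.truncn e^-1).+1; rewrite truncnS_gt.
exists k; rewrite exprVn invf_plt ?posrE ?exprn_gt0//.
apply: (lt_trans ke); rewrite -natrX ltr_nat; exact: ltn_expl.
Qed.

(* Steps longer than [2^-j] are ignored, so that the sequence is Cauchy for
   every [b]. *)
Fixpoint approx (R : realType) (V : Type) (d : V -> V -> R) (q : nat -> V)
    (b : baire) (k : nat) : V :=
  if k is j.+1 then
    if (d (approx d q b j) (q (b k)) <= 2^-1 ^+ j)%R then q (b k)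
    else approx d q b j
  else q (b 0).

(** [f b] is the limit of the sequence [approx d q b], for [q] a dense sequence. Its [k]-th term
    depends on finitely many entries of [b] and is uniformly close to the limit, whence continuity;
    a fast enough approximation of [x] by points of [q] is never altered, whence surjectivity. *)
Lemma polish_baire_surj (R : realType) (V : topologicalType) (v0 : V) :
  polish R V ->
  exists f : baire -> V, continuous f /\ forall x, exists b, f b = x.
Proof.
move=> [[D cD dD] [d [[d_ge0 d_eq0 dC d_tri] dV complete_d]]].
have dxx x : d x x = 0%R by apply/d_eq0.
have ballV x e : (0 < e)%R -> nbhs x [set y | (d x y < e)%R].
  by move=> e0; apply/dV; exists e.
have dense_ball x e : (0 < e)%R -> exists2 y, D y & (d x y < e)%R.
  move=> /(ballV x); rewrite nbhsE => -[U [oU Ux] Ue].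
  have [|y [Uy Dy]] := dD U _ oU; first by exists x.
  by exists y => //; exact: Ue.
have [|q Dq] := countable_enum cD.
  by have [y Dy _] := dense_ball v0 1%R ltr01; exists y.
have dense_q x e : (0 < e)%R -> exists k, (d x (q k) < e)%R.
  by rewrite -Dq in dense_ball => /(dense_ball x)[_ [k _ <-] ?]; exists k.
pose h k : R := (2^-1 ^+ k)%R.
have h0 k : (0 < h k)%R by rewrite exprn_gt0.
have hS k : (h k.+1 = h k / 2)%R by rewrite /h exprSr.
pose s := approx d q.
have step b k : (d (s b k) (s b k.+1) <= h k)%R.
  by rewrite /s /=; case: ifP => // _; rewrite dxx ltW.
(* Keeping the exact tail of the geometric series in the bound is what lets the induction close. *)
have step_sum b k j :
    (d (s b k) (s b (k + j)%N) <= 2 * h k - 2 * h (k + j)%N)%R.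
  elim: j => [|j IHj]; first by rewrite addn0 dxx subrr.
  rewrite addnS; have := d_tri (s b k) (s b (k + j)) (s b (k + j).+1).
  have := step b (k + j); rewrite hS; lra.
have step_le b k m : (k <= m)%N -> (d (s b k) (s b m) <= 2 * h k)%R.
  move=> km; have := step_sum b k (m - k).
  by rewrite subnKC//; have := h0 m; lra.
have /choice[f fP] b : exists l : V, s b @ \oo --> l.
  apply: complete_d => e e0; have [N Ne] := @halfX_lt R (e / 4)%R ltac:(lra).
  exists N => m k Nm Nk; rewrite -/(h N) in Ne.
  have := step_le b _ _ Nm; have := step_le b _ _ Nk.
  by have := d_tri (s b m) (s b N) (s b k); rewrite (dC (s b m) (s b N)); lra.
(* A later term is within [2 * h k] of the [k]-th one and, far enough out, within [h k] of the
   limit. *)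
have sf b k : (d (s b k) (f b) < 3 * h k)%R.
  have [N _ NP] := fP b _ (ballV (f b) (h k) (h0 k)).
  have := NP (maxn N k) (leq_maxl _ _); have := step_le b _ _ (leq_maxr N k).
  have := d_tri (s b k) (s b (maxn N k)) (f b).
  by rewrite /= (dC (f b)); lra.
exists f; split.
  move=> b; have s_loc k : nbhs b [set b' | s b' k = s b k].
    have loc j : nbhs b [set b' : baire | b' j = b j].
      have := @continuous_coord baire id j (@continuous_id baire).
      by move=> /(_ b [set b j]); apply; exact: discrete_set1.
    elim: k => [|k IHk].
      by apply: filterS (loc 0) => b' /=; rewrite /s /= => ->.
    apply: filterS (filterI IHk (loc k.+1)) => b' [/=].
    by rewrite /s /= => -> ->.
  (* Both limits lie within [3 * h k] of the common term, so [h k] below [e / 6] suffices. *)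
  move=> A /dV[e e0 eA]; have [k ke] := @halfX_lt R (e / 6)%R ltac:(lra).
  rewrite -/(h k) in ke; apply: filterS (s_loc k) => b' /= sb'; apply: eA => /=.
  have := sf b k; have := sf b' k; rewrite sb'.
  by have := d_tri (f b) (s b k) (f b'); rewrite (dC (f b) (s b k)); lra.
(* With the exponent [k.+1], consecutive approximations differ by less than [h k.+1 + h k.+2], that
   is three quarters of [h k], so every step is accepted. *)
move=> x; have /choice[b bP] k : exists i, (d x (q i) < h k.+1)%R.
  by apply: dense_q.
exists b; have sb k : s b k = q (b k).
  elim: k => [//|k IHk]; rewrite /s /= -/s -/(s b k) IHk.
  suff -> : (d (q (b k)) (q (b k.+1)) <= h k)%R by [].
  have := bP k; have := bP k.+1; have := d_tri (q (b k)) x (q (b k.+1)).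
  by rewrite (dC (q (b k)) x) !hS; have := h0 k; lra.
apply/d_eq0; apply/eqP; rewrite eq_le d_ge0 andbT leNgt; apply/negP => e0.
(* The distance from [f b] to [x] is less than [3 * h k + h k / 2], hence less than [4 * h k]. *)
have [k ke] := @halfX_lt R (d (f b) x / 4)%R ltac:(lra).
rewrite -/(h k) in ke; have := sf b k; have := bP k; rewrite sb hS.
by have := d_tri (f b) (q (b k)) x; rewrite (dC (f b) (q _)) (dC x); lra.
Qed.

(** Balls around two distinct points with radius half their distance are disjoint. *)
Lemma closed_diagonal (R : realType) (V : topologicalType) :
  polish R V -> closed [set p : V * V | p.1 = p.2].
Proof.
move=> [_ [d [[d_ge0 d_eq0 dC d_tri] dV _]]].
rewrite -openC openE => -[x y] /= xy.
have d0 : (0 < d x y)%R.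
  by rewrite lt_neqAle d_ge0 andbT eq_sym; apply/eqP => /d_eq0.
have ballV z : nbhs z [set t | (d z t < d x y / 2)%R].
  by apply/dV; exists (d x y / 2)%R => //; lra.
exists ([set t | (d x t < d x y / 2)%R], [set t | (d y t < d x y / 2)%R]).
  by split; exact: ballV.
move=> [u v] /= [xu yv] uv; rewrite -uv (dC y) in yv.
by have := d_tri x u y; lra.
Qed.

(** * Codes of labelled components *)

(** [ball_at E n x] holds the ends of walks of length exactly [n] from [x], so for symmetric [E]
    this is the connected component. *)
Definition component (V : Type) (E : set (V * V)) (x : V) : set V :=
  \bigcup_n ball_at E n x.

Lemma component_refl (V : Type) (E : set (V * V)) (x : V) : component E x x.
Proof. by exists 0. Qed.

Lemma component_adj (V : Type) (E : set (V * V)) (x y : V) :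
  is_graph E -> E (x, y) -> component E x = component E y.
Proof.
move=> symE Exy.
have sub u v : E (u, v) -> component E v `<=` component E u.
  by move=> Euv z [n _ nvz]; exists n.+1 => //=; exists v.
by apply/seteqP; split; apply: sub => //; exact: symE.
Qed.

Lemma countable_component (V : Type) (E : set (V * V)) (x : V) :
  locally_countable E -> countable (component E x).
Proof.
move=> lcE; apply: bigcup_countable => // n _; elim: n x => [|n IHn] x /=.
  exact: countable1.
by apply: bigcup_countable => [|y _]; [exact: lcE|exact: IHn].
Qed.

(** Induction on the length of a walk: the surjection [f] turns the quantifier over the next vertex
    into one over reals, and walks of length 0 give the closed diagonal. *)
Lemma Sigma1_component (n : nat) (V : topologicalType) (f : baire -> V)
    (E : set (V * V)) :
  continuous f -> (forall x, exists b, f b = x) ->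
  closed [set p : V * V | p.1 = p.2] -> Sigma1 n.+1 E ->
  Sigma1 n.+1 [set p : V * V | component E p.1 p.2].
Proof.
move=> cf sf diag SE.
suff Sball k : Sigma1 n.+1 [set p : V * V | ball_at E k p.1 p.2].
  rewrite (_ : mkset _ = [set p | exists k, ball_at E k p.1 p.2]).
    exact: Sigma1_bigcup Sball.
  by apply/predeqP => p /=; split=> -[k]; exists k.
elim: k => [|k IHk].
  rewrite (_ : mkset _ = [set p | p.1 = p.2]); last first.
    by apply/predeqP => p /=; split=> ->.
  by apply: Sigma1_borel; rewrite -[mkset _]setCK; apply: borelC;
    apply: borel_open; rewrite openC.
pose A := [set q : V * V * baire |
  E (q.1.1, f q.2) /\ ball_at E k (f q.2) q.1.2].
rewrite (_ : mkset _ = [set p : V * V | exists z, A (p, z)]).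
  have cfs : continuous (fun q : V * V * baire => f q.2).
    move=> q; apply: (@continuous_comp _ _ _ snd f); last exact: cf.
    exact: cvg_snd.
  apply: (@Sigma1_ex _ _ A); apply: Sigma1_and.
    apply: (@Sigma1_preimage _ _ _
      (fun q : V * V * baire => (q.1.1, f q.2)) _ _ SE).
    by cont.
  apply: (@Sigma1_preimage _ _ _
    (fun q : V * V * baire => (f q.2, q.1.2)) _ _ IHk).
  by cont.
apply/predeqP => -[x v] /=; split=> [[y /= Exy kyv]|[z [Exz kzv]]].
  by have [z zy] := sf y; exists z; rewrite /A /= zy.
by exists (f z).
Qed.

(* Slice [0] of a code lists the labels, slice [i.+1] codes the [i]-th
   vertex. *)
Definition vertex (V : Type) (f : baire -> V) (z : baire) (i : nat) : V :=
  f (slice z i.+1).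

Definition label (K : Type) (g : nat -> K) (z : baire) (i : nat) : K :=
  g (slice z 0 i).

(** Since an enumeration may list a vertex repeatedly, the second clause is what makes the labels a
    function of the vertex. *)
Definition coherent (V K : Type) (f : baire -> V) (g : nat -> K)
    (E : set (V * V)) (z : baire) : Prop :=
  (forall i j, E (vertex f z i, vertex f z j) -> label g z i <> label g z j) /\
  (forall i j, vertex f z i = vertex f z j -> label g z i = label g z j).

(** The set [A] is a parameter so that a component can be traded for the range of another real. *)
Definition codes (V K : Type) (f : baire -> V) (g : nat -> K)
    (E : set (V * V)) (A : set V) (z : baire) : Prop :=
  range (vertex f z) = A /\ coherent f g E z.

Definition least_code (V K : Type) (le : rel baire) (f : baire -> V)
    (g : nat -> K) (E : set (V * V)) (A : set V) (z : baire) : Prop :=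
  codes f g E A z /\ forall w, codes f g E A w -> le z w.

(** An enumeration of the countable component, labelled by the given colouring [c], is coded by some
    real. *)
Lemma codes_component (V K : Type) (f : baire -> V) (g : nat -> K)
    (E : set (V * V)) (c : V -> K) (x : V) :
  (forall x, exists b, f b = x) -> (forall k, exists i, g i = k) ->
  locally_countable E -> colouring E c ->
  exists z, codes f g E (component E x) z.
Proof.
move=> sf sg lcE cE.
have [|e eE] := countable_enum (@countable_component _ _ x lcE).
  by exists x; exact: component_refl.
have /choice[b bP] i : exists b, f b = e i by exact: sf.
have /choice[l lP] i : exists j, g j = c (e i) by exact: sg.
have [z zP] := slice_surj (fun k => if k is i.+1 then b i else l).
have vE i : vertex f z i = e i by rewrite /vertex zP.
have lE i : label g z i = c (e i) by rewrite /label zP.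
exists z; split; first by rewrite -eE (_ : vertex f z = e) //; apply: funext.
by split=> i j; rewrite !vE !lE; [exact: cE|move=> ->].
Qed.

Lemma least_code_unique (V K : Type) (le : rel baire) (f : baire -> V)
    (g : nat -> K) (E : set (V * V)) (A : set V) :
  well_order le -> (exists z, codes f g E A z) ->
  exists z, least_code le f g E A z /\
    forall w, least_code le f g E A w -> w = z.
Proof.
move=> wo [z0 z0A]; pose P : {pred baire} := [pred z | `[< codes f g E A z >]].
have PE w : least_code le f g E A w <-> minimum_of le P w.
  split=> [[Aw lew]|[/asboolP Aw lew]].
    by split=> [|t /asboolP/lew//]; apply/asboolP.
  by split=> // t At; apply: lew; apply/asboolP.
have [|z [zP uz]] := wo P; first by exists z0; apply/asboolP.
by exists z; split=> [|w /PE/uz //]; apply/PE.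
Qed.

(** * Complexity of codes and of least codes *)

Lemma continuous_vertex (X V : topologicalType) (f : baire -> V)
    (h : X -> baire) (i : nat) :
  continuous f -> continuous h -> continuous (fun x => vertex f (h x) i).
Proof.
move=> cf ch x.
apply: (@continuous_comp _ _ _ (fun x => slice (h x) i.+1) f); last exact: cf.
exact: continuous_slice.
Qed.

Lemma Delta1_eq (n : nat) (X V : topologicalType) (g h : X -> V) :
  closed [set p : V * V | p.1 = p.2] -> continuous g -> continuous h ->
  Delta1 n [set x | g x = h x].
Proof.
move=> diag cg ch.
apply: (@Delta1_preimage n X (V * V)%type
  (fun x => (g x, h x)) [set p | p.1 = p.2]).
  exact: continuous_pair.
split; last by apply: Sigma1_borel; apply: borel_open; rewrite openC.
apply: Sigma1_borel; rewrite -[mkset _]setCK; apply: borelC.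
by apply: borel_open; rewrite openC.
Qed.

Lemma Delta1_coherent (n : nat) (V : topologicalType) (K : Type)
    (f : baire -> V) (g : nat -> K) (E : set (V * V)) :
  continuous f -> closed [set p : V * V | p.1 = p.2] -> Delta1 n E ->
  Delta1 n [set z | coherent f g E z].
Proof.
move=> cf diag DE.
have cv i : continuous (fun z : baire => vertex f z i).
  by apply: continuous_vertex => //; exact: continuous_id.
have cl i : continuous (fun z : baire => slice z 0 i).
  apply: (@continuous_coord baire (fun z => slice z 0) i).
  by apply: continuous_slice; exact: continuous_id.
apply: Delta1_and; apply: Delta1_forall => i; apply: Delta1_forall => j.
  apply: Delta1_imply.
    apply: (@Delta1_preimage n baire (V * V)%type
      (fun z => (vertex f z i, vertex f z j)) E) => //.
    exact: continuous_pair.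
  exact: (@Delta1_nat n baire _ _ (fun a b => g a <> g b)).
apply: Delta1_imply; first exact: Delta1_eq.
exact: (@Delta1_nat n baire _ _ (fun a b => g a = g b)).
Qed.

(** Comparing two enumerations takes quantifiers over indices only, which is the gain from replacing
    a component by a real that enumerates it. *)
Lemma Delta1_eq_range_vertex (n : nat) (X V : topologicalType)
    (f : baire -> V) (g h : X -> baire) :
  continuous f -> closed [set p : V * V | p.1 = p.2] ->
  continuous g -> continuous h ->
  Delta1 n [set x | range (vertex f (g x)) = range (vertex f (h x))].
Proof.
move=> cf diag cg ch.
rewrite (_ : mkset _ = [set x |
    (forall i, exists j, vertex f (g x) i = vertex f (h x) j) /\
    (forall j, exists i, vertex f (g x) i = vertex f (h x) j)]).
  apply: Delta1_and; apply: Delta1_forall => i; apply: Delta1_exists => j;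
    by apply: Delta1_eq => //; apply: continuous_vertex.
apply/predeqP => x /=; split=> [gh|[gh hg]].
  split=> [i|j].
    have : range (vertex f (g x)) (vertex f (g x) i) by exists i.
    by rewrite gh => -[j _ <-]; exists j.
  have : range (vertex f (h x)) (vertex f (h x) j) by exists j.
  by rewrite -gh => -[i _ <-]; exists i.
apply/seteqP; split=> _ [i _ <-].
  by have [j ->] := gh i; exists j.
by have [j <-] := hg i; exists j.
Qed.

(** Being contained in the component is [Sigma1 n.+1]; exhausting it is [Pi1 n.+1], as [component]
    occurs there as a premise. Both fit into [Sigma1 n.+2]. *)
Lemma Sigma1_range_vertex_component (n : nat) (V : topologicalType)
    (f : baire -> V) (E : set (V * V)) :
  continuous f -> (forall x, exists b, f b = x) ->
  closed [set p : V * V | p.1 = p.2] -> Sigma1 n.+1 E ->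
  Sigma1 n.+2 [set p : V * baire | range (vertex f p.2) = component E p.1].
Proof.
move=> cf sf diag SE; have SC := Sigma1_component cf sf diag SE.
pose A := [set q : V * baire * baire | component E q.1.1 (f q.2) ->
  exists i, vertex f q.1.2 i = f q.2].
rewrite (_ : mkset _ = [set p : V * baire |
    (forall i, component E p.1 (vertex f p.2 i)) /\ forall b, A (p, b)]).
  apply: Sigma1_and.
    apply: Sigma1_bigcap => i; apply: Sigma1S.
    apply: (@Sigma1_preimage _ _ _
      (fun p : V * baire => (p.1, vertex f p.2 i)) _ _ SC).
    apply: continuous_pair; first by cont.
    by apply: continuous_vertex => //; cont.
  apply: Pi1_Sigma1S; apply: (@Pi1_forall _ _ A).
  have cf2 : continuous (fun q : V * baire * baire => f q.2).
    move=> q; apply: (@continuous_comp _ _ _ snd f); last exact: cf.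
    exact: cvg_snd.
  apply: (@Pi1_setC _ _ _ [set q : V * baire * baire |
      component E q.1.1 (f q.2) /\ ~ exists i, vertex f q.1.2 i = f q.2]).
    by apply/predeqP => q; rewrite /A /= not_implyP.
  apply: Sigma1_and.
    apply: (@Sigma1_preimage _ _ _
      (fun q : V * baire * baire => (q.1.1, f q.2)) _ _ SC).
    by apply: continuous_pair => //; cont.
  apply: (proj1 (Delta1C _)); apply: Delta1_exists => i.
  by apply: Delta1_eq => //; apply: continuous_vertex => //; cont.
apply/predeqP => -[x z]; rewrite /A /=; split=> [<-|[zC Cz]].
  by split=> [i|b [i _ <-]]; exists i.
apply/seteqP; split=> [_ [i _ <-] //|y].
by have [b <-] := sf y => /Cz[i <-]; exists i.
Qed.

(** Relative to the real [p.1], being a code is [Delta1 n.+1], so minimality costs one universal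
    quantifier over reals. *)
Lemma Pi1_least_code (n : nat) (V : topologicalType) (K : Type)
    (le : rel baire) (f : baire -> V) (g : nat -> K) (E : set (V * V)) :
  continuous f -> closed [set p : V * V | p.1 = p.2] -> Delta1 n.+1 E ->
  Delta1 n.+1 [set p : baire * baire | le p.1 p.2] ->
  Pi1 n.+1 [set p : baire * baire |
    least_code le f g E (range (vertex f p.1)) p.2].
Proof.
move=> cf diag DE Dle; have DG := @Delta1_coherent _ _ _ _ g _ cf diag DE.
pose A := [set q : baire * baire * baire |
  codes f g E (range (vertex f q.1.1)) q.2 -> le q.1.2 q.2].
have Dcodes (X : topologicalType) (h k : X -> baire) :
    continuous h -> continuous k ->
    Delta1 n.+1 [set x | codes f g E (range (vertex f (h x))) (k x)].
  move=> ch ck; apply: Delta1_and; first exact: Delta1_eq_range_vertex.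
  exact: (Delta1_preimage ck DG).
suff PA : Pi1 n.+1 A.
  apply: (@Pi1_setC _ _ _ [set p : baire * baire |
      ~ codes f g E (range (vertex f p.1)) p.2 \/ ~ forall t, A (p, t)]).
    by apply/predeqP => p; rewrite /A /= not_andP.
  apply: Sigma1_or; last exact: (@Pi1_forall _ _ A PA).
  by apply: (proj1 (Delta1C _)); apply: Dcodes; cont.
apply: (proj2 (@Delta1_imply n.+1 _ _ _ _ _)); first by apply: Dcodes; cont.
by apply: (@Delta1_preimage _ _ _
  (fun q : baire * baire * baire => (q.1.2, q.2)) _ _ Dle); cont.
Qed.

(** * The colouring read off from least codes *)

Lemma class_colourable_countable (R : realType) (n : nat) (V : topologicalType)
    (E : set (V * V)) (K : Type) :
  (exists le : rel baire,
    well_order le /\ Delta1 n.+1 [set p : baire * baire | le p.1 p.2]) ->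
  polish R V -> is_graph E -> Delta1 n.+1 E -> locally_countable E ->
  countable [set: K] -> colourable E K ->
  class_colourable (@Delta1 n.+2 V) E K.
Proof.
move=> [le [wo Dle]] polV symE DE lcE cK [c cE].
(* The empty space is no image of the Baire space; all its subsets are empty, so any colouring
   works. *)
have [[v0 _]|V0] := pselect (exists v : V, True); last first.
  have S0 (A : set V) : Sigma1 n.+2 A.
    rewrite (_ : A = set0); first by apply: Sigma1_borel; exact: sigma_algebra0.
    by apply/seteqP; split=> // x; case: V0; exists x.
  by exists c; split=> // k; split; exact: S0.
have diag := closed_diagonal polV.
have [f [cf sf]] := polish_baire_surj v0 polV.
have [|g gK] := countable_enum cK; first by exists (c v0).
have sg k : exists i, g i = k.
  by have : [set: K] k by []; rewrite -gK => -[i _ <-]; exists i.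
have /choice[m mP] x : exists z, least_code le f g E (component E x) z /\
    forall w, least_code le f g E (component E x) w -> w = z.
  exact: (least_code_unique wo (codes_component x sf sg lcE cE)).
(* Adjacent vertices have the same component, hence the same least code by uniqueness. *)
have m_adj x y : E (x, y) -> m x = m y.
  move=> Exy; apply: (mP y).2; rewrite -(component_adj symE Exy).
  exact: (mP x).1.
have /choice[d dP] x : exists k, exists i,
    vertex f (m x) i = x /\ label g (m x) i = k.
  have [[mx _] _] := (mP x).1; have := component_refl E x.
  by rewrite -mx => -[i _ xi]; exists (label g (m x) i), i.
(* Both labels are read in one code, whose labelling is proper. *)
have dE : colouring E d.
  move=> x y Exy; have [i [xi <-]] := dP x; have [j [yj <-]] := dP y.
  rewrite -(m_adj _ _ Exy) in yj *.
  by have [[_ [+ _]] _] := (mP x).1; apply; rewrite xi yj.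
(* Here [q.1.2] enumerates the component of [q.1.1], and [q.2] is the least code relative to that
   enumeration. *)
pose B k := [set q : V * baire * baire |
  range (vertex f q.1.2) = component E q.1.1 /\
  (least_code le f g E (range (vertex f q.1.2)) q.2 /\
   exists i, vertex f q.2 i = q.1.1 /\ label g q.2 i = k)].
have SB k : Sigma1 n.+2 (B k).
  apply: Sigma1_and.
    apply: (@Sigma1_preimage _ _ _ (fun q : V * baire * baire => q.1) _ _
      (Sigma1_range_vertex_component cf sf diag DE.1)).
    by cont.
  apply: Sigma1_and.
    apply: (@Sigma1_preimage _ _ _
      (fun q : V * baire * baire => (q.1.2, q.2)) _ _
      (Pi1_Sigma1S (Pi1_least_code g cf diag DE Dle))).
    by cont.
  apply: (proj1 (Delta1_exists _)) => i; apply: Delta1_and.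
    by apply: Delta1_eq => //; [apply: continuous_vertex => //|]; cont.
  by apply: (@Delta1_nat _ _ (fun q : V * baire * baire => slice q.2 0 i)
    (fun q : V * baire * baire => slice q.2 0 i) (fun a _ => g a = k)); cont.
have Sd k : Sigma1 n.+2 [set x | d x = k].
  pose A := [set p : V * baire | exists z, B k (p, z)].
  rewrite (_ : mkset _ = [set x | exists w, A (x, w)]).
    by apply: (@Sigma1_ex _ _ A); exact: (@Sigma1_ex _ _ (B k)).
  apply/predeqP => x; rewrite /A /B /=.
  split=> [<-|[w [z [wx [zP [i [zi <-]]]]]]].
    have [i [xi di]] := dP x; have [[mx _] _] := (mP x).1.
    (* The least code itself serves as the enumeration of the component. *)
    exists (m x), (m x); split=> //=; split.
      by rewrite mx; exact: (mP x).1.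
    by exists i.
  rewrite /= in wx zP zi *; rewrite wx in zP.
  (* Uniqueness identifies [z] with [m x]; coherence then makes the label independent of the index
     at which [x] is listed. *)
  have zm := (mP x).2 _ zP; rewrite zm in zi *.
  have [j [xj <-]] := dP x; have [[_ [_ mc]] _] := (mP x).1.
  by apply: mc; rewrite xj.
exists d; split=> // k; split; first exact: Sd.
(* The complement of a colour class is the countable union of the other classes. *)
apply: (@Pi1_setC _ _ _ [set x | exists i, g i <> k /\ d x = g i]).
  apply/predeqP => x /=; split=> [dk|[i [gik ->]] //].
  by have [i gi] := sg (d x); exists i; rewrite gi.
apply: Sigma1_bigcup => i; apply: Sigma1_and; last exact: Sd.
exact: (@Sigma1_nat _ V (fun=> i) [set j | g j <> k] (@cst_continuous _ _ i)).
Qed.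

(** A colouring with classes in [Delta1 n.+1] is a colouring, so it remains to realise the chromatic
    number by such a colouring. Any colouring excludes loops, which makes the chromatic number
    countable. *)
Theorem theorem4p8 (R : realType) (n : nat) (hn : (2 <= n)%N)
    (hwo : exists le : rel baire,
       well_order le /\ Delta1 n [set p : baire * baire | le p.1 p.2])
    (V : topologicalType) (hV : polish R V) (E : set (V * V))
    (hE : is_graph E) (hEn : Delta1 n E) (hlc : locally_countable E) :
  forall kappa : Type,
    class_chromatic_number (@Delta1 n.+1 V) E kappa <-> chromatic_number E kappa.
Proof.
case: n hn hwo hEn => [//|n] _ hwo hEn kappa.
have class_col K : class_colourable (@Delta1 n.+2 V) E K -> colourable E K.
  by move=> [c [cE _]]; exists c.
have irr K : colourable E K -> forall x, ~ E (x, x).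
  by move=> [c cE] x /cE.
have col_class K : chromatic_number E K ->
    class_colourable (@Delta1 n.+2 V) E K.
  move=> [colK minK]; apply: (class_colourable_countable hwo hV) => //.
  (* Minimality against [nat] is exactly countability of [K]. *)
  by apply: (minK nat); exact: colourable_nat (irr K colK).
split=> [[/class_col col_kappa min_kappa]|chi_kappa].
  split=> // K colK.
  (* [kappa] is minimal only among types with a class colouring, so the comparison with [K] passes
     through an attained chromatic number [K0], which has one. *)
  have [K0 chi_K0] := chromatic_number_ex hE hlc (irr K colK).
  by apply: card_le_trans (chi_K0.2 K colK); apply: min_kappa; exact: col_class.
split=> [|K /class_col]; first exact: col_class.
exact: chi_kappa.2.
Qed.
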